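(* Let $G=(V,E)$ be an undirected connected graph, $S\subset V$, and $|S|=2$. Then $S$ is a minimal perfect critical set (a minimal perfect critical 2 set) if and only if for every $v\in V\setminus S$, either $N_S(v)=\emptyset$ or $N_S(v)=S$.
   Context: Graphs are finite, simple, undirected and unweighted. $N_S(v)=\{u\in S : uv\in E\}$. The Laplacian of $G$ is $\mathbf{L}=\Delta-D$, with $\Delta$ the diagonal matrix of vertex degrees and $D$ the adjacency matrix. For a vector $\mathbf{y}$ indexed by $V$, $\mathbf{y}_T$ is its restriction to $T\subseteq V$. A nonempty set $S\subseteq V$ is a critical set (CS) if there is an eigenvector $\mathbf{y}$ of $\mathbf{L}$ with $\mathbf{y}_{V\setminus S}=\mathbf{0}$ (an inducing eigenvector). $S$ is a perfect critical set (PCS) if there is an eigenvector $\mathbf{y}$ of $\mathbf{L}$ with $\mathbf{y}_{V\setminus S}=\mathbf{0}$ and $\mathbf{y}_v\neq 0$ for all $v\in S$. $S$ is a minimal perfect critical set (MPCS) if it is a PCS and no proper subset of it is a PCS; it is called a minimal perfect critical $k$ set if moreover $|S|=k$. *)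

(* Defs.v *)
From HB Require Import structures.
From mathcomp Require Import all_boot all_order all_algebra.
From mathcomp Require Import reals.

Set Implicit Arguments.
Unset Strict Implicit.
Unset Printing Implicit Defensive.

Import GRing.Theory.
Local Open Scope ring_scope.

(* A simple graph is an adjacency relation [e] on a finite vertex type [V],
   with [symmetric e] and [irreflexive e] as hypotheses of the theorem.
   Matrices and vectors indexed by [V] are represented over ['I_#|V|] through
   the bijections [enum_val] / [enum_rank]. *)

Definition neighbors_in (V : finType) (e : rel V) (S : {set V}) (v : V) :
  {set V} := [set u in S | e u v].

Definition degree (V : finType) (e : rel V) (v : V) : nat :=
  #|neighbors_in e [set: V] v|.

Definition connected_graph (V : finType) (e : rel V) : Prop :=
  forall u v : V, connect e u v.

Definition degree_mx (R : realType) (V : finType) (e : rel V) : 'M[R]_#|V| :=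
  diag_mx (\row_i (degree e (enum_val i))%:R).

Definition adjacency_mx (R : realType) (V : finType) (e : rel V) :
  'M[R]_#|V| := \matrix_(i, j) (e (enum_val i) (enum_val j))%:R.

Definition laplacian (R : realType) (V : finType) (e : rel V) : 'M[R]_#|V| :=
  degree_mx R e - adjacency_mx R e.

Definition eigenvector (R : realType) (n : nat) (A : 'M[R]_n) (y : 'cV[R]_n) :
  Prop := y != 0 /\ exists lambda : R, A *m y = lambda *: y.

Definition perfect_critical_set (R : realType) (V : finType) (e : rel V)
    (S : {set V}) : Prop :=
  exists y : 'cV[R]_#|V|,
    [/\ eigenvector (laplacian R e) y,
        forall v : V, v \notin S -> y (enum_rank v) ord0 = 0
      & forall v : V, v \in S -> y (enum_rank v) ord0 != 0].

Definition minimal_perfect_critical_set (R : realType) (V : finType)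
    (e : rel V) (S : {set V}) : Prop :=
  perfect_critical_set R e S /\
  forall T : {set V}, T \proper S -> ~ perfect_critical_set R e T.

(* Main.v *)
Require Import Defs.
From HB Require Import structures.
From mathcomp Require Import all_boot all_order all_algebra.
From mathcomp Require Import perm reals.

(** Let [y] be an eigenvector of the Laplacian [L] whose support is exactly
    [S].  Row [v] of [L y = lambda y], for [v] outside [S], says that the
    entries of [y] over the neighbours of [v] in [S] sum to zero.  Since these
    entries are nonzero, [v] cannot have exactly one neighbour in [S]
    ([card_neighbors_in_neq1]).

    This single obstruction gives two things.  When [#|S| = 2] it leaves only
    the possibilities [set0] and [S] for the neighbours of [v] in [S].  It also
    rules out supports of size one in a connected graph with at least two
    vertices ([perfect_critical_card_gt1]), because the lone vertex of the
    support would be the only neighbour in it of some outside vertex; hence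
    minimality is automatic for a set of size two.

    Conversely, if every vertex outside [S = {a, b}] sees both or neither of
    [a] and [b], then [a] and [b] are twins: they have the same degree, and
    [1_a - 1_b] is an eigenvector for the eigenvalue [degree a + e a b]
    ([twins_perfect_critical]). *)

Import GRing.Theory.

Section LaplacianSupport.

Local Open Scope ring_scope.

Context {R : realType} {V : finType} {e : rel V}.

Lemma laplacian_mulE (y : 'cV[R]_#|V|) (v : V) :
  (laplacian R e *m y) (enum_rank v) ord0 =
  (degree e v)%:R * y (enum_rank v) ord0
  - \sum_u (e v u)%:R * y (enum_rank u) ord0.
Proof.
rewrite /laplacian mulmxBl /degree_mx mul_diag_mx !mxE enum_rankK; congr (_ - _).
rewrite (reindex (@enum_rank V)); last exact/onW_bij/enum_rank_bij.
by apply: eq_bigr => u _; rewrite !mxE !enum_rankK.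
Qed.

Lemma sum_adjacent_support {S : {set V}} {y : 'cV[R]_#|V|} (v : V) :
    symmetric e ->
    (forall u, u \notin S -> y (enum_rank u) ord0 = 0) ->
  \sum_u (e v u)%:R * y (enum_rank u) ord0 =
  \sum_(u in neighbors_in e S v) y (enum_rank u) ord0.
Proof.
move=> e_sym y0; rewrite [RHS]big_mkcond; apply: eq_bigr => u _.
rewrite inE e_sym; have [_|/y0->] := boolP (u \in S); last by rewrite mulr0.
by case: (e u v); rewrite ?mul1r ?mul0r.
Qed.

(** Otherwise row [v] of the eigenvalue equation would force the entry of the
    inducing eigenvector at the unique neighbour to vanish. *)
Lemma card_neighbors_in_neq1 {S : {set V}} {v : V} :
    symmetric e -> perfect_critical_set R e S -> v \notin S ->
  #|neighbors_in e S v| != 1%N.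
Proof.
move=> e_sym [y [[_ [lambda Ly]] y0 yN0]] vNS.
apply/negP => /cards1P[w Nw].
have wS : w \in S by have := set11 w; rewrite -Nw inE => /andP[].
have := congr1 (fun A : 'cV[R]__ => A (enum_rank v) ord0) Ly.
rewrite laplacian_mulE (sum_adjacent_support v e_sym y0) Nw big_set1 mxE y0 //.
rewrite !mulr0 sub0r => /eqP; rewrite oppr_eq0.
by apply/negP; exact: yN0.
Qed.

Lemma perfect_critical_neq0 {S : {set V}} :
  perfect_critical_set R e S -> S != set0.
Proof.
move=> [y [[yN0 _] y0 _]]; apply: contraNneq yN0 => S0.
apply/eqP/colP => i; rewrite mxE -[i]enum_valK y0 //.
by rewrite S0 inE.
Qed.

Lemma connected_has_neighbor {a b : V} :
  connected_graph e -> a != b -> exists c, e a c.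
Proof.
move=> /(_ a b)/connectP[[|c p] /= path_p ->]; first by rewrite eqxx.
by case/andP: path_p => eac _; exists c.
Qed.

(** A support [set a] is impossible: connectedness gives [a] a neighbour [c],
    and [a] is then the only neighbour of [c] in the support. *)
Lemma perfect_critical_card_gt1 {S : {set V}} :
    symmetric e -> irreflexive e -> connected_graph e -> (1 < #|V|)%N ->
  perfect_critical_set R e S -> (1 < #|S|)%N.
Proof.
move=> e_sym e_irr e_conn V_gt1 S_pcs.
have S_gt0 : (0 < #|S|)%N by rewrite card_gt0 perfect_critical_neq0.
rewrite ltn_neqAle S_gt0 andbT eq_sym; apply/negP => /cards1P[a Sa].
have [b bNa] : exists b, a != b.
  have /card_gt0P[b] : (0 < #|predC1 a|)%N by rewrite cardC1 -ltnS prednK // ltnW.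
  by rewrite inE eq_sym; exists b.
have [c eac] := connected_has_neighbor e_conn bNa.
have cNS : c \notin S.
  by rewrite Sa inE; apply: contraTneq eac => ->; rewrite e_irr.
have := card_neighbors_in_neq1 e_sym S_pcs cNS.
suff -> : neighbors_in e S c = [set a] by rewrite cards1.
by apply/setP => u; rewrite !inE Sa inE; case: eqP => // ->.
Qed.

(** The transposition of [a] and [b] matches the neighbours of [a] with those
    of [b]. *)
Lemma twins_degree {a b : V} :
    symmetric e -> irreflexive e ->
    (forall v, v \notin [set a; b] -> e a v = e b v) ->
  degree e a = degree e b.
Proof.
move=> e_sym e_irr twin.
rewrite /degree -(card_imset _ (@perm_inj _ (tperm a b))); congr #|pred_of_set _|.
apply/setP => v; rewrite -[v in LHS](tpermK a b) mem_imset; last exact: perm_inj.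
rewrite !inE /=; case: tpermP => [->|->|/eqP vNa /eqP vNb]; rewrite ?e_irr //.
by rewrite !(e_sym v) twin // !inE negb_or vNa.
Qed.

(** The inducing eigenvector is [1_a - 1_b].  In the row of an outside vertex
    the two nonzero entries cancel or are both absent; the rows of [a] and [b]
    give the eigenvalues [degree e a + e a b] and [degree e b + e b a], which
    agree because twins have equal degrees. *)
Lemma twins_perfect_critical {a b : V} :
    symmetric e -> irreflexive e -> a != b ->
    (forall v, v \notin [set a; b] -> e a v = e b v) ->
  perfect_critical_set R e [set a; b].
Proof.
move=> e_sym e_irr aNb twin.
pose y : 'cV[R]_#|V| :=
  \col_i ((enum_val i == a)%:R - (enum_val i == b)%:R).
have yE v : y (enum_rank v) ord0 = (v == a)%:R - (v == b)%:R.
  by rewrite mxE enum_rankK.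
have ya : y (enum_rank a) ord0 = 1 by rewrite yE eqxx (negPf aNb) subr0.
have yb : y (enum_rank b) ord0 = -1.
  by rewrite yE eqxx eq_sym (negPf aNb) sub0r.
have y0 v : v \notin [set a; b] -> y (enum_rank v) ord0 = 0.
  by rewrite yE !inE negb_or => /andP[/negPf-> /negPf->]; rewrite subrr.
have sum_y v : \sum_u (e v u)%:R * y (enum_rank u) ord0
               = (e v a)%:R - (e v b)%:R.
  rewrite (bigD1 a) //= (bigD1 b) 1?eq_sym //= big1 ?addr0 ?ya ?yb.
    by rewrite mulr1 mulrN1.
  by move=> u /andP[uNa uNb]; rewrite y0 ?mulr0 // !inE negb_or uNa.
exists y; split => [|//|v]; last first.
  by rewrite !inE => /orP[]/eqP->; rewrite ?ya ?yb ?oppr_eq0 oner_neq0.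
split.
  by apply/eqP => /matrixP/(_ (enum_rank a) ord0)/eqP; rewrite ya mxE oner_eq0.
exists ((degree e a)%:R + (e a b)%:R); apply/colP => i.
rewrite -[i]enum_valK; move: (enum_val i) => v.
rewrite laplacian_mulE sum_y [RHS]mxE.
have [|vNab] := boolP (v \in [set a; b]); last first.
  by rewrite y0 // !mulr0 !(e_sym v) twin // subrr subr0.
rewrite !inE => /orP[]/eqP->; first by rewrite ya !mulr1 e_irr sub0r opprK.
by rewrite yb !mulrN1 e_irr subr0 (e_sym b) -(twins_degree e_sym e_irr twin) opprD.
Qed.

End LaplacianSupport.

Theorem theorem1 (R : realType) (V : finType) (e : rel V)
    (e_sym : symmetric e) (e_irrefl : irreflexive e)
    (e_conn : connected_graph e)
    (S : {set V}) (S_card : #|S| = 2) :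
  minimal_perfect_critical_set R e S <->
  (forall v : V, v \notin S ->
     neighbors_in e S v = set0 \/ neighbors_in e S v = S).
Proof.
split=> [[S_pcs _] v vNS | N_S].
  have NS_sub : neighbors_in e S v \subset S.
    by apply/subsetP => u; rewrite inE => /andP[].
  have := card_neighbors_in_neq1 e_sym S_pcs vNS.
  have := subset_leq_card NS_sub; rewrite S_card.
  case NS_card: #|neighbors_in e S v| => [|[|[|//]]] // _ _.
    by left; apply: cards0_eq.
  by right; apply/eqP; rewrite eqEcard NS_sub S_card NS_card.
split=> [|T T_S T_pcs].
  have /eqP/cards2P[a [b [aNb Sab]]] := S_card; rewrite Sab.
  apply: twins_perfect_critical => // v; rewrite -Sab => vNS.
  have N_E u : u \in S -> e u v = (u \in neighbors_in e S v).
    by move=> uS; rewrite inE uS.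
  have [aS bS] : a \in S /\ b \in S by rewrite Sab !inE !eqxx orbT.
  by rewrite !N_E //; case: (N_S v vNS) => ->; rewrite ?inE ?aS ?bS.
have V_gt1 : 1 < #|V| by rewrite -S_card max_card.
have := perfect_critical_card_gt1 e_sym e_irrefl e_conn V_gt1 T_pcs.
by rewrite ltnNge -ltnS -S_card proper_card.
Qed.
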